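(* Let $d\ge 1$, let $G=(\mathbb{Z}/2\mathbb{Z})^d=\{0,1\}^d$ with Lee distance $\delta$, and let $f:\mathbb{Z}_+\to\mathbb{R}_+$ be a function such that $(-1)^m\Delta^m[f](x)>0$ for all $x\in\mathbb{Z}_+$ and all integers $m\ge 0$, where $\Delta[f](x)=f(x+1)-f(x)$. Let $u(g,h)=f(\delta(g,h))$ for $g\ne h$ in $G$, with corresponding energy kernel $A$, total energy $E_{\text{tot}}$ and maximal energy $E_{\text{max}}$. Then the fractional energy $(x|Ax)$ over all $x\in V=\mathbb{R}^G$ with $(x|x)=(x|\mathbf{1})=|G|/2=2^{d-1}$ is minimised by the characteristic vectors $x_{S_{\text{even}}}$ and $x_{S_{\text{odd}}}$ of the checkerboard configurations \[ S_{\text{even}}=\{(g_1,\ldots,g_d)\in G\mid \textstyle\sum_i g_i \text{ even}\},\qquad S_{\text{odd}}=\{(g_1,\ldots,g_d)\in G\mid \textstyle\sum_i g_i \text{ odd}\}, \] and only by these. As a consequence, both the total energy $E_{\text{tot}}(S)$ and the maximal energy $E_{\text{max}}(S)$ among all subsets $S\subseteq G$ with $|S|=2^{d-1}$ are minimised by $S_{\text{even}}$ and $S_{\text{odd}}$, and only by these.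
   Context: $\mathbb{Z}_+$ and $\mathbb{R}_+$ denote the positive integers and the positive real numbers. $\Delta^m$ is the $m$-fold iterate of the forward difference operator $\Delta$ (with $\Delta^0[f]=f$). Lee distance: form the graph on $G$ in which two elements are joined by an edge if they differ by $(0,\ldots,0,1,0,\ldots,0)$ for some position of the $1$; $\delta(g,h)$ is the length of a shortest path from $g$ to $h$ (i.e. the number of coordinates in which $g$ and $h$ differ). For $S\subseteq G$ and $h\in S$, put $E_h(S)=\sum_{g\in S\setminus\{h\}}u(h,g)$, $E_{\text{max}}(S)=\max_{h\in S}E_h(S)$ and $E_{\text{tot}}(S)=\sum_{h\in S}E_h(S)$. $V=\mathbb{R}^G$ is the space of real-valued functions on $G$, with inner product $(x|y)=\sum_{g\in G}x(g)y(g)$; $\mathbf{1}\in V$ is the all-one vector; $x_S\in V$ is the characteristic (0/1) vector of $S\subseteq G$. The energy kernel $A$ is the linear map $V\to V$ given by $(Ax)(h)=\sum_{g\in G,\,g\neq 0}u(g,0)\,x(h-g)$. *)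

(* Defs.v *)
From HB Require Import structures.
From mathcomp Require Import all_boot all_order all_algebra.
From mathcomp Require Import reals.

Set Implicit Arguments.
Unset Strict Implicit.
Unset Printing Implicit Defensive.

Import Order.TTheory GRing.Theory Num.Theory.
Local Open Scope ring_scope.

Section Minimisation.
Variables (R : realType) (T : Type).

Definition is_minimiser (P : T -> Prop) (F : T -> R) (x : T) : Prop :=
  P x /\ forall y, P y -> F x <= F y.

End Minimisation.

Section Energy.
Variables (R : realType) (G : finZmodType).

(* Only the values u g h with g != h matter in the definitions below. *)
Variable u : G -> G -> R.

Definition energy_at (S : {set G}) (h : G) : R := \sum_(g in S :\ h) u h g.

(* The seed 0 is harmless: it is a lower bound of all the energies when u is
   nonnegative off the diagonal. *)
Definition energy_max (S : {set G}) : R :=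
  \big[Order.max/0]_(h in S) energy_at S h.

Definition energy_tot (S : {set G}) : R := \sum_(h in S) energy_at S h.

Definition energy_kernel (x : {ffun G -> R}) : {ffun G -> R} :=
  [ffun h => \sum_(g | g != 0) u g 0 * x (h - g)].

End Energy.

Section FunctionSpace.
Variables (R : realType) (G : finZmodType).

Definition inner (x y : {ffun G -> R}) : R := \sum_g x g * y g.

Definition all_one : {ffun G -> R} := [ffun=> 1].

Definition charvec (S : {set G}) : {ffun G -> R} := [ffun g => (g \in S)%:R].

Definition fractional_energy (u : G -> G -> R) (x : {ffun G -> R}) : R :=
  inner x (energy_kernel u x).

End FunctionSpace.

Arguments all_one {R G}.
Arguments charvec {R G} S.

Definition fdiff (R : realType) (f : nat -> R) : nat -> R :=
  fun x => f x.+1 - f x.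

(* f stands for a function on the positive integers: since iter m fdiff f x
   only involves f x, ..., f (x + m), the value f 0 is never used. *)
Definition strictly_completely_monotone (R : realType) (f : nat -> R) : Prop :=
  forall m x : nat, (0 < x)%N -> 0 < (-1) ^+ m * iter m (@fdiff R) f x.

Notation cube d := ('rV['Z_2]_d).

Section Cube.
Variable d : nat.
Implicit Types g h : cube d.

(* Symmetric, since - delta_mx 0 i = delta_mx 0 i over 'Z_2. *)
Definition cube_edge : rel (cube d) :=
  fun g h => [exists i : 'I_d, h - g == delta_mx 0 i].

Definition cube_walk g h (n : nat) : bool :=
  [exists p : n.-tuple (cube d), path cube_edge g p && (last g p == h)].

Lemma cube_connected g h : exists n, cube_walk g h n.
Proof.
pose K (v : cube d) := forall g, exists n, cube_walk g (g + v) n.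
suff: K (h - g) by move=> /(_ g); rewrite addrC subrK.
rewrite [h - g]row_sum_delta; apply: (big_ind K) => [k|v w Kv Kw k|i _ k].
- by exists 0; apply/existsP; exists [tuple]; rewrite /= addr0.
- have [m /existsP[p /andP[pP /eqP pE]]] := Kv k.
  have [n /existsP[q /andP[qP /eqP qE]]] := Kw (k + v).
  exists (m + n)%N; apply/existsP; exists [tuple of p ++ q].
  by rewrite /= cat_path last_cat pE pP qP qE addrA /=.
- case: ((h - g) 0 i) => -[|[|//]] lt2.
    exists 0; apply/existsP; exists [tuple].
    by rewrite (_ : Ordinal lt2 = 0) ?scale0r ?addr0 //=; apply: val_inj.
  exists 1; apply/existsP; exists [tuple k + delta_mx 0 i].
  rewrite (_ : Ordinal lt2 = 1) ?scale1r; last exact: val_inj.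
  by rewrite /= eqxx !andbT; apply/existsP; exists i; rewrite addrC addKr.
Qed.

Definition lee_dist g h : nat := ex_minn (cube_connected g h).

(* Coordinates are read in nat through their representatives 0 and 1. *)
Definition coord_sum g : nat := (\sum_(i < d) nat_of_ord (g 0%R i))%N.

Definition S_even : {set cube d} := [set g | ~~ odd (coord_sum g)].
Definition S_odd : {set cube d} := [set g | odd (coord_sum g)].

End Cube.

Arguments S_even {d}.
Arguments S_odd {d}.

Definition lee_potential (R : realType) (f : nat -> R) (d : nat)
    (g h : cube d) : R := f (lee_dist g h).
Arguments lee_potential {R} f {d} g h.

(* Main.v *)
(* The characters chi_t of the cube diagonalise the energy kernel, with
   eigenvalues l_t = sum_(g <> 0) f(|g|) chi_t(g). If t_i = 0, then
   l_t - l_(t + e_i) is twice a sum of values of iterates of 1 + S and 1 - S (S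
   the shift) applied to f, which is positive by complete monotonicity. Hence
   l_t is strictly smallest at t = (1,...,1). The constraints fix the Fourier
   coefficient of x at 0 and the sum of squares of the others, so the minimum
   puts all the remaining mass at (1,...,1), that is x = (1 +- chi_(1,...,1)) / 2.
   For the maximal energy: E_tot(S) <= |S| E_max(S), with equality for the
   checkerboards, where E_h does not depend on h. *)
Require Import Defs.
From HB Require Import structures.
From mathcomp Require Import all_boot all_order all_algebra.
From mathcomp Require Import reals ring lra.

Set Implicit Arguments.
Unset Strict Implicit.
Unset Printing Implicit Defensive.

Import Order.TTheory GRing.Theory Num.Theory.
Local Open Scope ring_scope.

(** * Complete monotonicity under the operators 1 + S and 1 - S, S the shift *)

Section CompleteMonotonicity.
Variable R : realType.
Implicit Types F : nat -> R.

Lemma iter_fdiff_shift F (s : R) m x :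
  iter m (@fdiff R) (fun n => F n + s * F n.+1) x =
  iter m (@fdiff R) F x + s * iter m (@fdiff R) F x.+1.
Proof. by elim: m x => //= m IHm x; rewrite /fdiff !IHm; ring. Qed.

(** For [a = 0] the signed differences are sums of two positive terms. For [a = 1] the new function
    is minus the difference of [F], so its signed differences of order [m] are those of [F] of order
    [m + 1]. *)
Lemma scm_signed_shift F (a : 'Z_2) : strictly_completely_monotone F ->
  strictly_completely_monotone (fun n => F n + (-1) ^+ a * F n.+1).
Proof.
move=> Fmono m x x_gt0; rewrite iter_fdiff_shift.
case: a => [[|[|//]] lt_a2] /=.
  by rewrite expr0 mul1r mulrDr addr_gt0 ?Fmono.
have := Fmono m.+1 x x_gt0; rewrite iterS /fdiff exprS.
by rewrite expr1 => /lt_le_trans; apply; rewrite le_eqVlt; apply/orP; left;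
  apply/eqP; ring.
Qed.

End CompleteMonotonicity.

(** * Lee distance as Hamming weight *)

Section CubeWeight.
Variable d : nat.
Implicit Types (g h t : cube d) (i : 'I_d).

Lemma Z2_eq0P (a : 'Z_2) : a != 0 -> a = 1.
Proof. by case: a => [[|[|//]] lt_a2] // _; apply: val_inj. Qed.

Lemma cube_addvv g : g + g = 0.
Proof.
apply/matrixP=> j i; rewrite !mxE.
by case: (g j i) => [[|[|//]] lt_a2]; apply: val_inj.
Qed.

Lemma cube_opp g : - g = g.
Proof. by apply/eqP; rewrite eq_sym -subr_eq0 opprK cube_addvv. Qed.

Lemma cube_flipK i : involutive (fun g => g + delta_mx 0 i).
Proof. by move=> g; rewrite -addrA cube_addvv addr0. Qed.

Lemma flip_coord g i j :
  (g + delta_mx 0 i) 0 j = g 0 j + (j == i)%:R.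
Proof. by rewrite !mxE eqxx. Qed.

Lemma coord_sum0 : coord_sum (0 : cube d) = 0%N.
Proof. by rewrite /coord_sum big1 // => i _; rewrite mxE. Qed.

Lemma coord_sum_eq0 g : (coord_sum g == 0)%N = (g == 0).
Proof.
apply/eqP/eqP=> [|->]; last exact: coord_sum0.
move/eqP; rewrite sum_nat_eq0 => /forallP g0; apply/rowP => i.
by apply: val_inj; rewrite mxE; apply/eqP/g0.
Qed.

Lemma coord_sum_flip g i : g 0 i = 0 ->
  coord_sum (g + delta_mx 0 i) = (coord_sum g).+1.
Proof.
move=> gi0; rewrite /coord_sum (bigD1 i) //= [in RHS](bigD1 i) //=.
rewrite flip_coord gi0 eqxx add0r /= add1n add0n; congr _.+1.
by apply: eq_bigr => j /negPf ji; rewrite flip_coord ji addr0.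
Qed.

Lemma coord_sum_flip_le g i :
  (coord_sum (g + delta_mx 0%R i)%R <= (coord_sum g).+1)%N.
Proof.
have [gi0|/Z2_eq0P gi1] := eqVneq (g 0 i) 0; first by rewrite coord_sum_flip.
have wi0 : (g + delta_mx 0 i) 0 i = 0.
  by rewrite flip_coord gi1 eqxx; apply: val_inj.
have := coord_sum_flip wi0; rewrite (cube_flipK i g) => ->.
exact: leqW (leqnSn _).
Qed.

(** Flipping one by one the coordinates where [g] and [h] differ gives such a walk; this bounds the
    distance from above. *)
Lemma cube_walk_coord_sum g h : cube_walk g h (coord_sum (g + h)).
Proof.
(* With the target written [g + v], the induction on the weight of [v] is free to move the starting
   point [g]. *)
rewrite -{1}[h](addKr g) cube_opp; move: (g + h) => v {h}.
move eq_n: (coord_sum v) => n; elim: n v g eq_n => [|n IHn] v g.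
  move/eqP; rewrite coord_sum_eq0 => /eqP ->; apply/existsP.
  by exists [tuple]; rewrite /= addr0.
move=> wtv; have [i vi|v0] := pickP (fun i => v 0 i != 0); last first.
  suff v00 : v = 0 by rewrite v00 coord_sum0 in wtv.
  by apply/rowP=> i; rewrite mxE; apply/eqP/negbFE/v0.
have wi0 : (v + delta_mx 0 i) 0 i = 0.
  by rewrite flip_coord (Z2_eq0P vi) eqxx; apply: val_inj.
have wtw : coord_sum (v + delta_mx 0 i) = n.
  by apply: succn_inj; rewrite -wtv -(coord_sum_flip wi0) (cube_flipK i v).
have /existsP[p /andP[pP /eqP lastp]] := IHn _ (g + delta_mx 0 i) wtw.
apply/existsP; exists [tuple of (g + delta_mx 0 i) :: p].
rewrite /= pP lastp andbT; apply/andP; split; last first.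
  by rewrite addrACA cube_addvv addr0.
by apply/existsP; exists i; rewrite addrC addKr.
Qed.

(** An edge flips one coordinate, so it changes the weight of the difference by at most one. *)
Lemma coord_sum_cube_walk g h n : cube_walk g h n -> (coord_sum (g + h)%R <= n)%N.
Proof.
case/existsP=> p /andP[pP /eqP <-]; rewrite -{2}(size_tuple p).
elim: {n p}(tval p) g pP => [|k p IHp] g /=; first by rewrite cube_addvv coord_sum0.
case/andP=> /existsP[i /eqP kE] /IHp wt_le.
apply: leq_trans (_ : (coord_sum (k + last k p)%R).+1 <= _)%N; last by [].
suff -> : g + last k p = k + last k p + delta_mx 0 i by apply: coord_sum_flip_le.
by rewrite -kE cube_opp addrACA cube_addvv add0r addrC.
Qed.

Lemma lee_distE g h : lee_dist g h = coord_sum (g + h).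
Proof.
rewrite /lee_dist; case: ex_minnP => n /coord_sum_cube_walk wt_le n_min.
by apply/eqP; rewrite eqn_leq wt_le n_min ?cube_walk_coord_sum.
Qed.

End CubeWeight.

(** * Fourier analysis on the cube *)

Section Walsh.
Variables (R : realType) (d : nat).
Implicit Types (g h t : cube d) (i : 'I_d) (x y : {ffun cube d -> R}).

(** The character (-1)^(t.g), with exponents taken in nat through the representatives 0 and 1. It is
    symmetric in [t] and [g]. *)
Definition walsh t g : R := \prod_i (-1) ^+ (t 0%R i * g 0%R i)%N.

Lemma walshC t g : walsh t g = walsh g t.
Proof. by apply: eq_bigr => i _; rewrite mulnC. Qed.

Lemma walshD t g h : walsh t (g + h) = walsh t g * walsh t h.
Proof.
rewrite -big_split; apply: eq_bigr => i _ /=; rewrite mxE.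
case: (t 0 i) => [[|[|//]] lt_t2] /=; first by rewrite !mul0n expr0 mulr1.
rewrite !mul1n.
case: (g 0 i) (h 0 i) => [[|[|//]] lt_g2] [[|[|//]] lt_h2] /=;
  rewrite /= ?expr0 ?expr1; ring.
Qed.

Lemma walsh_delta t i : walsh t (delta_mx 0 i) = (-1) ^+ t 0%R i.
Proof.
rewrite /walsh (bigD1 i) //= big1 => [|j /negPf ji]; rewrite mxE eqxx.
  by rewrite eqxx muln1 mulr1.
by rewrite ji muln0 expr0.
Qed.

Lemma walsh0 g : walsh 0 g = 1.
Proof. by apply: big1 => i _; rewrite mxE mul0n. Qed.

Lemma walsh1 g : walsh (const_mx 1) g = (-1) ^+ coord_sum g.
Proof.
rewrite /coord_sum expr_sum; apply: eq_bigr => i _.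
by rewrite mxE mul1n.
Qed.

Local Notation N := (#|{: cube d}|%:R : R).

(** If [g] has a nonzero coordinate [i], flipping [t] at [i] changes the sign of every term, so the
    sum equals its own opposite. *)
Lemma sum_walsh g : \sum_t walsh t g = N * (g == 0)%:R.
Proof.
have [->|g_neq0] := eqVneq g 0.
  under eq_bigr do rewrite walshC walsh0.
  by rewrite sumr_const mulr1.
have [i gi|g0] := pickP (fun i => g 0 i != 0); last first.
  by case/eqP: g_neq0; apply/rowP=> i; rewrite mxE; apply/eqP/negbFE/g0.
rewrite mulr0; set S := \sum_t _.
suff: S = - S by lra.
rewrite {1}/S (reindex_inj (can_inj (cube_flipK i))) /= -sumrN.
apply: eq_bigr => t _; rewrite walshC walshD walsh_delta (Z2_eq0P gi) expr1.
by rewrite walshC mulrN1.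
Qed.

(** Unnormalised, whence the factor [N] in Parseval's identity and in the inversion formula. *)
Definition walsh_transform x t : R := \sum_g walsh t g * x g.

Lemma walsh_transform_walsh s t :
  walsh_transform [ffun g => walsh s g] t = N * (t == s)%:R.
Proof.
rewrite /walsh_transform; under eq_bigr do rewrite ffunE [walsh t _]walshC
  [walsh s _]walshC -walshD.
by rewrite sum_walsh addr_eq0 cube_opp.
Qed.

(** Summing over [t] first leaves only the diagonal terms, by orthogonality of characters. *)
Lemma walsh_parseval x y :
  \sum_t walsh_transform x t * walsh_transform y t = N * inner x y.
Proof.
transitivity (\sum_t \sum_g \sum_h x g * y h * walsh t (g + h)).
  apply: eq_bigr => t _; rewrite big_distrlr; apply: eq_bigr => g _.
  by apply: eq_bigr => h _; rewrite walshD /=; ring.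
rewrite exchange_big /inner mulr_sumr; apply: eq_bigr => g _ /=.
rewrite exchange_big (bigD1 g) //= [X in _ + X]big1 => [|h h_neq_g].
  by rewrite -mulr_sumr sum_walsh cube_addvv eqxx /=; ring.
by rewrite -mulr_sumr sum_walsh addr_eq0 cube_opp eq_sym (negPf h_neq_g) /=; ring.
Qed.

Lemma walsh_inversion x g :
  \sum_t walsh t g * walsh_transform x t = N * x g.
Proof.
transitivity (\sum_t \sum_h x h * walsh t (g + h)).
  apply: eq_bigr => t _; rewrite mulr_sumr.
  by apply: eq_bigr => h _; rewrite walshD /=; ring.
rewrite exchange_big (bigD1 g) //= [X in _ + X]big1 => [|h h_neq_g].
  by rewrite -mulr_sumr sum_walsh cube_addvv eqxx /=; ring.
by rewrite -mulr_sumr sum_walsh addr_eq0 cube_opp eq_sym (negPf h_neq_g) /=; ring.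
Qed.

Definition kernel_eigenvalue (u : cube d -> cube d -> R) t : R :=
  \sum_(g | g != 0) u g 0 * walsh t g.

(** The kernel is convolution with [u g 0] off the origin, and the transform turns convolutions into
    products. *)
Lemma walsh_transform_kernel u x t :
  walsh_transform (energy_kernel u x) t =
  kernel_eigenvalue u t * walsh_transform x t.
Proof.
rewrite /walsh_transform /kernel_eigenvalue mulr_suml.
under eq_bigr do rewrite ffunE mulr_sumr.
rewrite exchange_big; apply: eq_bigr => g _ /=.
rewrite (reindex_inj (addIr g)) mulr_sumr; apply: eq_bigr => h _ /=.
by rewrite addrK walshD; ring.
Qed.

Lemma fractional_energy_walsh u x :
  N * fractional_energy u x =
  \sum_t kernel_eigenvalue u t * walsh_transform x t ^+ 2.
Proof.
rewrite -walsh_parseval; apply: eq_bigr => t _.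
by rewrite walsh_transform_kernel; ring.
Qed.

End Walsh.

(** * Strict minimality of the eigenvalue at (1,...,1) *)

Section Eigenvalues.
Variables (R : realType) (d : nat).
Implicit Types (g h t : cube d) (i : 'I_d) (A : {set 'I_d}).

(** The subcube spanned by the coordinates in [A], so that coordinates can be summed out one at a
    time. *)
Definition supported A g := [forall i, (g 0 i != 0) ==> (i \in A)].

Lemma supported0 g : supported set0 g = (g == 0).
Proof.
apply/forallP/eqP=> [g0|-> i]; last by rewrite mxE eqxx.
apply/rowP=> i; rewrite mxE; apply/eqP/negPn/negP=> gi.
by have := g0 i; rewrite gi inE.
Qed.

Lemma supported_flip A i g : i \in A ->
  supported A (g + delta_mx 0 i) = supported A g.
Proof.
move=> iA; apply: eq_forallb => j; rewrite flip_coord.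
by have [->|_] := eqVneq j i; rewrite ?iA ?implybT ?addr0.
Qed.

Lemma supportedD1 A i g :
  supported (A :\ i) g = supported A g && (g 0 i == 0).
Proof.
apply/forallP/andP=> [gA|[/forallP gA gi0] j].
  split; last by apply/negPn/negP=> gi; have := gA i; rewrite gi !inE eqxx.
  apply/forallP=> j; apply/implyP=> gj.
  by have := gA j; rewrite gj inE => /andP[].
apply/implyP=> gj; rewrite !inE (implyP (gA j) gj) andbT.
by apply: contraNneq gj => ->.
Qed.

Lemma sum_supportedD1 A i (F : cube d -> R) : i \in A ->
  \sum_(g | supported A g) F g =
  \sum_(g | supported (A :\ i) g) (F g + F (g + delta_mx 0 i)).
Proof.
move=> iA; rewrite big_split (bigID (fun g => g 0 i == 0)) /=; congr (_ + _).
  by apply: eq_bigl => g; rewrite supportedD1.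
rewrite (reindex_inj (can_inj (cube_flipK i))) /=.
apply: eq_bigl => g; rewrite supported_flip // supportedD1 flip_coord eqxx.
by congr (_ && _); case: (g 0 i) => [[|[|//]] lt_g2].
Qed.

(* Summing out one coordinate i replaces f by f + (-1)^(t_i) f(. + 1), which is
   again completely monotone. *)
Lemma sum_supported_walsh_gt0 A t (f : nat -> R) :
  strictly_completely_monotone f ->
  0 < \sum_(g | supported A g) f (coord_sum g).+1 * walsh R t g.
Proof.
move eq_n: #|A| => n; elim: n => [|n IHn] in A eq_n f * => f_mono.
  move/eqP: eq_n; rewrite cards_eq0 => /eqP ->.
  rewrite (eq_bigl _ _ supported0) big_pred1_eq walshC walsh0 mulr1 coord_sum0.
  by have := f_mono 0 1 isT; rewrite expr0 mul1r.
have [i iA] : exists i, i \in A by apply/card_gt0P; rewrite eq_n.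
rewrite (sum_supportedD1 _ iA).
have eq_n' : #|A :\ i| = n by move: eq_n; rewrite (cardsD1 i) iA add1n => -[].
under eq_bigr => g.
  rewrite supportedD1 => /andP[_ /eqP gi0].
  rewrite coord_sum_flip // walshD walsh_delta.
  rewrite (_ : _ + _ = (f (coord_sum g).+1 + (-1) ^+ t 0 i * f (coord_sum g).+2)
                       * walsh R t g); last by ring.
  over.
exact: (IHn _ eq_n' _ (scm_signed_shift (t 0 i) f_mono)).
Qed.

Variable f : nat -> R.
Hypothesis f_mono : strictly_completely_monotone f.

Local Notation eigenvalue := (kernel_eigenvalue (@lee_potential R f d)).

(** In the difference of the two eigenvalues the terms with [g 0 i = 0] cancel and the others
    double. Writing the latter as flips at [i] of vectors vanishing there turns weights into
    successors, as in [sum_supported_walsh_gt0]. *)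
Lemma eigenvalue_flip t i : t 0 i = 0 ->
  eigenvalue (t + delta_mx 0 i) < eigenvalue t.
Proof.
move=> ti0; rewrite -subr_gt0 -sumrB.
pose F g := f (coord_sum g) * walsh R t g * (1 - (-1) ^+ g 0 i).
rewrite (eq_bigr F); last first.
  move=> g _; rewrite /lee_potential lee_distE addr0 /F.
  by rewrite !(walshC _ _ g) walshD walsh_delta; ring.
(* The last factor vanishes at the origin, so the excluded term can be restored and the sum taken
   over the whole cube. *)
have F0 : F 0 = 0 by rewrite /F mxE expr0 subrr mulr0.
suff: 0 < \sum_g F g by rewrite (bigD1 0) //= F0 add0r.
rewrite (eq_bigl (supported setT)); last first.
  by move=> g; apply/esym/forallP => j; rewrite inE implybT.
rewrite (sum_supportedD1 _ (in_setT i)).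
rewrite (eq_bigr (fun g => 2 * (f (coord_sum g).+1 * walsh R t g))).
  by rewrite -mulr_sumr mulr_gt0 ?sum_supported_walsh_gt0.
move=> g; rewrite supportedD1 => /andP[_ /eqP gi0].
rewrite /F coord_sum_flip // flip_coord gi0 eqxx add0r walshD walsh_delta ti0.
by rewrite !expr0 expr1; ring.
Qed.

(** A global minimiser has no zero coordinate, since flipping it would lower the eigenvalue; hence
    it is (1,...,1). For any other [t], one flip already gives strictness. *)
Lemma eigenvalue_min t : t != const_mx 1 ->
  eigenvalue (const_mx 1) < eigenvalue t.
Proof.
have zero_coord (s : cube d) : s != const_mx 1 -> exists i, s 0 i = 0.
  move=> s1; have [i /eqP si|s0] := pickP (fun i => s 0 i == 0); first by exists i.
  case/eqP: s1; apply/rowP=> i; rewrite mxE.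
  by apply: Z2_eq0P; rewrite s0.
have [s _ s_min] := arg_minP eigenvalue (erefl true : predT (0 : cube d)).
have s1 : s = const_mx 1.
  apply/eqP/negPn/negP=> /zero_coord[i /eigenvalue_flip].
  by rewrite ltNge s_min.
move=> /zero_coord[i /eigenvalue_flip]; apply: le_lt_trans.
by rewrite -s1; apply: s_min.
Qed.

End Eigenvalues.

(** Common form of the three claims: a strict gap away from [a] and [b] gives both minimality and
    uniqueness. *)
Lemma is_minimiserP (R : realType) (T : Type) (P : T -> Prop) (F : T -> R) a b x :
  P a -> P b -> F a = F b ->
  (forall y, P y -> [\/ y = a, y = b | F a < F y]) ->
  is_minimiser P F x <-> x = a \/ x = b.
Proof.
move=> Pa Pb Fab P_cases.
have F_min y : P y -> F a <= F y.
  by case/P_cases=> [->|->|/ltW //]; rewrite ?Fab.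
split=> [[Px x_min]|[] ->]; last 2 first.
- by split.
- by split=> // y; rewrite -Fab; apply: F_min.
case: (P_cases x Px) => [->|->|]; [by left|by right|].
by rewrite ltNge x_min.
Qed.

(** * Checkerboards and their Fourier transforms *)

Section Checkerboard.
Variables (R : realType) (d : nat).
Hypothesis d_gt0 : (0 < d)%N.
Implicit Types (g h t : cube d) (x y : {ffun cube d -> R}) (S : {set cube d}).

Local Notation N := (#|{: cube d}|%:R : R).

Lemma cardR_cube_gt0 : 0 < N.
Proof. by rewrite ltr0n; apply/card_gt0P; exists 0. Qed.

Lemma card_cube : #|{: cube d}| = (2 ^ d)%N.
Proof. by rewrite card_mx card_ord mul1n. Qed.

Lemma half_card_cube : N / 2 = (2 ^ (d - 1))%:R.
Proof.
by rewrite card_cube -{1}(subnK d_gt0) addn1 expnS natrM mulrC mulKf ?pnatr_eq0.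
Qed.

Lemma const1_neq0 : const_mx 1 != 0 :> cube d.
Proof.
by apply/eqP=> /rowP/(_ (Ordinal d_gt0)); rewrite !mxE => /eqP; rewrite oner_eq0.
Qed.

(* For b = false, true these are the vectors (1 + chi) / 2 and (1 - chi) / 2,
   with chi the character of the all-one vector: the checkerboards. *)
Definition parity_set (b : bool) : {set cube d} :=
  [set g | odd (coord_sum g) == b].

Lemma parity_setE :
  (S_even = parity_set false :> {set cube d}) *
  (S_odd = parity_set true :> {set cube d}).
Proof.
by split; apply/setP=> g; rewrite !inE; case: odd.
Qed.

Lemma charvec_parityE b g :
  charvec (parity_set b) g = (1 + (-1) ^+ b * walsh R (const_mx 1) g) / 2.
Proof.
rewrite ffunE inE walsh1 -[_ ^+ coord_sum g]signr_odd.
case: b (odd _) => [] [] /=; rewrite ?expr0 ?expr1; lra.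
Qed.

Lemma transform_charvec_parity b t :
  walsh_transform (charvec (parity_set b)) t =
  N / 2 * ((t == 0)%:R + (-1) ^+ b * (t == const_mx 1)%:R).
Proof.
transitivity ((walsh_transform [ffun g => walsh R 0 g] t +
   (-1) ^+ b * walsh_transform [ffun g => walsh R (const_mx 1) g] t) / 2).
  rewrite /walsh_transform mulr_sumr -big_split mulr_suml.
  by apply: eq_bigr => g _; rewrite charvec_parityE !ffunE walsh0 /=; field.
by rewrite !walsh_transform_walsh; field.
Qed.

Lemma inner_charvec S : inner (charvec S) (charvec S) = #|S|%:R :> R.
Proof.
rewrite -sum1_card natr_sum [RHS]big_mkcond; apply: eq_bigr => g _.
by rewrite !ffunE; case: (g \in S); rewrite /= ?mulr1 ?mulr0.
Qed.

Lemma inner_charvec1 S : inner (charvec S) all_one = #|S|%:R :> R.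
Proof.
rewrite -sum1_card natr_sum [RHS]big_mkcond; apply: eq_bigr => g _.
by rewrite !ffunE; case: (g \in S); rewrite /= ?mulr1 ?mulr0.
Qed.

Lemma walsh_transform0 x : walsh_transform x 0 = inner x all_one.
Proof. by apply: eq_bigr => g _; rewrite walsh0 ffunE mulrC. Qed.

(** The cardinality is the transform at 0, to which the mode (1,...,1) does not contribute because
    [d] is positive. *)
Lemma card_parity_set b : #|parity_set b| = (2 ^ (d - 1))%N.
Proof.
apply/eqP; rewrite -(eqr_nat R) -half_card_cube -inner_charvec1.
rewrite -walsh_transform0 transform_charvec_parity eqxx [0 == _]eq_sym.
by rewrite (negPf const1_neq0) mulr0 addr0 mulr1.
Qed.

Definition half_mass x := inner x x = N / 2 /\ inner x all_one = N / 2.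

Lemma half_mass_charvec S : #|S| = (2 ^ (d - 1))%N -> half_mass (charvec S).
Proof. by move=> cS; split; rewrite ?inner_charvec ?inner_charvec1 half_card_cube cS. Qed.

Lemma charvec_inj : injective (@charvec R (cube d)).
Proof.
move=> S T /ffunP eqST; apply/setP=> g; have := eqST g; rewrite !ffunE.
by case: (g \in S) (g \in T) => [] [] // /eqP; rewrite ?oner_eq0 // eq_sym oner_eq0.
Qed.

(** * The fractional minimisation problem *)

Section Spectral.
Variable u : cube d -> cube d -> R.

Local Notation eigenvalue := (kernel_eigenvalue u).
Hypothesis eigenvalue_min : forall t, t != const_mx 1 ->
  eigenvalue (const_mx 1) < eigenvalue t.

(** The constraints fix the transform at 0 and, by Parseval, give the other modes total square
    (N/2)^2. Placing all of it at (1,...,1) yields the constant; the sum is the excess over it. *)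
Lemma fractional_energy_gap x : half_mass x ->
  N * fractional_energy u x =
  (eigenvalue 0 + eigenvalue (const_mx 1)) * (N / 2) ^+ 2 +
  \sum_(t | t != 0)
     (eigenvalue t - eigenvalue (const_mx 1)) * walsh_transform x t ^+ 2.
Proof.
case=> xx x1.
have parseval : \sum_(t | t != 0) walsh_transform x t ^+ 2 =
    N * (N / 2) - (N / 2) ^+ 2.
  have := walsh_parseval x x.
  rewrite xx (bigD1 0) //= walsh_transform0 x1 -expr2 => <-.
  by rewrite addrAC subrr add0r.
rewrite fractional_energy_walsh (bigD1 0) //= walsh_transform0 x1.
under [in RHS]eq_bigr do rewrite mulrBl.
by rewrite sumrB -[X in _ - X]mulr_sumr parseval; field.
Qed.

Lemma fractional_energy_parity b :
  N * fractional_energy u (charvec (parity_set b)) =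
  (eigenvalue 0 + eigenvalue (const_mx 1)) * (N / 2) ^+ 2.
Proof.
rewrite fractional_energy_gap; last exact/half_mass_charvec/card_parity_set.
rewrite big1 ?addr0 // => t /negPf t0; rewrite transform_charvec_parity t0.
by have [->|_] := eqVneq t (const_mx 1); rewrite ?subrr ?mul0r //=; ring.
Qed.

Lemma fractional_energy_parity_eq b c :
  fractional_energy u (charvec (parity_set b)) =
  fractional_energy u (charvec (parity_set c)).
Proof.
by apply: (mulfI (lt0r_neq0 cardR_cube_gt0)); rewrite !fractional_energy_parity.
Qed.

(** Parseval determines the coefficient at (1,...,1) up to sign; the sign selects the checkerboard,
    and Fourier inversion recovers [x]. *)
Lemma half_mass_two_modes x : half_mass x ->
  (forall t, t != 0 -> t != const_mx 1 -> walsh_transform x t = 0) ->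
  exists b, x = charvec (parity_set b).
Proof.
move=> [xx x1] x_modes.
have : walsh_transform x (const_mx 1) ^+ 2 = (N / 2) ^+ 2.
  have := walsh_parseval x x; rewrite xx (bigD1 0) //= walsh_transform0 x1.
  rewrite (bigD1 (const_mx 1)) ?const1_neq0 //= big1 => [|t /andP[t0 t1]].
    rewrite addr0 => E; rewrite expr2; apply: (addrI (N / 2 * (N / 2))).
    by rewrite E; field.
  by rewrite x_modes ?mul0r.
move/eqP; rewrite eqf_sqr => hat1.
have [b hatb] : exists b : bool, walsh_transform x (const_mx 1) = (-1) ^+ b * (N / 2).
  by case/orP: hat1 => /eqP ->; [exists false | exists true];
    rewrite ?expr0 ?expr1 ?mul1r ?mulN1r.
exists b; apply/ffunP=> g; apply: (mulfI (lt0r_neq0 cardR_cube_gt0)).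
rewrite -!walsh_inversion; apply: eq_bigr => t _; congr (_ * _).
rewrite transform_charvec_parity.
have [->|t0] := eqVneq t 0.
  by rewrite eq_sym (negPf const1_neq0) walsh_transform0 x1 mulr0 addr0 mulr1.
have [->|t1] := eqVneq t (const_mx 1); last by rewrite x_modes //= mulr0 addr0 mulr0.
by rewrite hatb /=; ring.
Qed.

(** A nonzero mode besides 0 and (1,...,1) makes the excess strictly positive; without one, [x] is a
    checkerboard. *)
Lemma fractional_energy_min x : half_mass x ->
  [\/ x = charvec (parity_set false), x = charvec (parity_set true) |
      fractional_energy u (charvec (parity_set false)) < fractional_energy u x].
Proof.
move=> x_half; have [t /and3P[t0 t1 xt]|x_modes] :=
  pickP (fun t => [&& t != 0, t != const_mx 1 & walsh_transform x t != 0]).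
  apply: Or33; rewrite -(ltr_pM2l cardR_cube_gt0) fractional_energy_parity.
  rewrite fractional_energy_gap // ltrDl (bigD1 t) //=.
  apply: ltr_pwDl.
    by rewrite mulr_gt0 ?subr_gt0 ?eigenvalue_min ?exprn_even_gt0.
  apply: sumr_ge0 => s _; apply: mulr_ge0; last exact: sqr_ge0.
  (* The mode (1,...,1) is among the remaining ones, with coefficient zero. *)
  rewrite subr_ge0; have [->//|s1] := eqVneq s (const_mx 1).
  exact/ltW/eigenvalue_min.
have [|[] ->] := half_mass_two_modes x_half; last 2 first.
- exact: Or32.
- exact: Or31.
move=> t t0 t1; apply/eqP/negPn/negP=> xt.
by have := x_modes t; rewrite t0 t1 xt.
Qed.

End Spectral.

(** * Total and maximal energies of subsets *)

Section Subsets.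
Variable f : nat -> R.
Hypothesis f_mono : strictly_completely_monotone f.
Local Notation u := (@lee_potential R f d).

Lemma energy_at_shift S h :
  energy_at u S h = \sum_(g | (g != 0) && (h - g \in S)) u g 0.
Proof.
rewrite /energy_at (reindex_inj (inj_comp (addrI h) (@oppr_inj _))) /=.
apply: eq_big => [g|g _].
  by rewrite !inE -{2}[h]addr0 (inj_eq (addrI h)) oppr_eq0.
by rewrite /lee_potential !lee_distE addrA cube_addvv add0r cube_opp addr0.
Qed.

Lemma energy_tot_fractional S :
  energy_tot u S = fractional_energy u (charvec S).
Proof.
rewrite /energy_tot big_mkcond; apply: eq_bigr => h _; rewrite !ffunE.
case: (h \in S); rewrite ?mul0r // mul1r energy_at_shift big_mkcondr /=.
by apply: eq_bigr => g _; rewrite ffunE; case: ifP; rewrite ?mulr1 ?mulr0.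
Qed.

Lemma energy_tot_min S : #|S| = (2 ^ (d - 1))%N ->
  [\/ S = parity_set false, S = parity_set true |
      energy_tot u (parity_set false) < energy_tot u S].
Proof.
move/half_mass_charvec/(fractional_energy_min (eigenvalue_min f_mono)).
rewrite !energy_tot_fractional.
by case=> [/charvec_inj|/charvec_inj|] E; [apply: Or31|apply: Or32|apply: Or33].
Qed.

Lemma energy_tot_le_max S : energy_tot u S <= #|S|%:R * energy_max u S.
Proof.
rewrite mulr_natl -sumr_const; apply: ler_sum => h hS.
exact: (le_bigmax_cond _ (fun h => energy_at u S h)).
Qed.

(** Needed to absorb the seed 0 of the maximum in [energy_max]. *)
Lemma energy_at_ge0 S h : 0 <= energy_at u S h.
Proof.
rewrite energy_at_shift; apply: sumr_ge0 => g /andP[g0 _].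
rewrite /lee_potential lee_distE addr0; apply: ltW.
by have := f_mono 0; rewrite /= expr0 => /(_ (coord_sum g)); rewrite mul1r; apply;
  rewrite lt0n coord_sum_eq0.
Qed.

(** Parity is the exponent of the character of (1,...,1), which is multiplicative. *)
Lemma odd_coord_sumD g h :
  odd (coord_sum (g + h)) = odd (coord_sum g) (+) odd (coord_sum h).
Proof.
apply/eqP; rewrite -(inj_eq (@signr_inj R)) signr_addb !signr_odd.
by rewrite -!walsh1 walshD.
Qed.

(** Subtracting [g] preserves parity exactly when [g] is even, so the energy depends neither on [h]
    nor on [b]. *)
Lemma energy_at_parity b h : h \in parity_set b ->
  energy_at u (parity_set b) h =
  \sum_(g | (g != 0) && ~~ odd (coord_sum g)) u g 0.
Proof.
rewrite inE energy_at_shift => /eqP hb; apply: eq_bigl => g.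
by rewrite inE cube_opp odd_coord_sumD hb; case: b (odd _) {hb} => [] [].
Qed.

(** All points have equal energy, so the maximum is the average. *)
Lemma energy_max_parity b :
  #|parity_set b|%:R * energy_max u (parity_set b) = energy_tot u (parity_set b).
Proof.
apply: le_anti; rewrite energy_tot_le_max andbT.
have [h hb] : exists h, h \in parity_set b.
  by apply/card_gt0P; rewrite card_parity_set expn_gt0.
rewrite /energy_tot (eq_bigr _ (fun k kb => energy_at_parity kb)).
rewrite sumr_const -[leRHS]mulr_natl ler_wpM2l ?ler0n //.
apply: bigmax_le => [|k /energy_at_parity -> //].
by rewrite -(energy_at_parity hb) energy_at_ge0.
Qed.

(** The strict gap in total energy passes to the maximum: average and maximum agree on
    checkerboards, and in general the average is at most the maximum. *)
Lemma energy_max_min S : #|S| = (2 ^ (d - 1))%N ->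
  [\/ S = parity_set false, S = parity_set true |
      energy_max u (parity_set false) < energy_max u S].
Proof.
move=> cS; case: (energy_tot_min cS) => [->|->|lt_tot].
- exact: Or31.
- exact: Or32.
apply: Or33; have c_gt0 : 0 < (2 ^ (d - 1))%:R :> R by rewrite ltr0n expn_gt0.
rewrite -(ltr_pM2l c_gt0) -{1}(card_parity_set false) energy_max_parity.
by apply: lt_le_trans lt_tot _; rewrite -cS energy_tot_le_max.
Qed.

End Subsets.

End Checkerboard.

Theorem theorem4p1 (R : realType) (d : nat) (d_ge1 : (1 <= d)%N)
    (f : nat -> R) (f_pos : forall n : nat, (0 < n)%N -> 0 < f n)
    (f_mono : strictly_completely_monotone f) :
  (forall x : {ffun cube d -> R},
     is_minimiser
       (fun y : {ffun cube d -> R} =>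
          inner y y = #|{: cube d}|%:R / 2 /\
          inner y all_one = #|{: cube d}|%:R / 2)
       (fractional_energy (lee_potential f)) x
     <-> x = charvec S_even \/ x = charvec S_odd) /\
  (forall S : {set cube d},
     is_minimiser (fun T : {set cube d} => #|T| = (2 ^ (d - 1))%N)
       (energy_tot (lee_potential f)) S
     <-> S = S_even \/ S = S_odd) /\
  (forall S : {set cube d},
     is_minimiser (fun T : {set cube d} => #|T| = (2 ^ (d - 1))%N)
       (energy_max (lee_potential f)) S
     <-> S = S_even \/ S = S_odd).
Proof.
have card_parity b : #|parity_set d b| = (2 ^ (d - 1))%N.
  exact: (card_parity_set R).
have tot_eq : energy_tot (lee_potential f) (parity_set d false) =
              energy_tot (lee_potential f) (parity_set d true).
  by rewrite !energy_tot_fractional; apply: fractional_energy_parity_eq.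
rewrite !parity_setE; split=> [x|]; last split=> S.
- apply: is_minimiserP; try exact/half_mass_charvec.
  + exact: fractional_energy_parity_eq.
  + exact: (fractional_energy_min d_ge1 (eigenvalue_min f_mono)).
- apply: is_minimiserP => //; exact: (energy_tot_min d_ge1 f_mono).
- apply: is_minimiserP => //; last exact: (energy_max_min d_ge1 f_mono).
  (* Equality of the two maximal energies follows from [tot_eq] after multiplying by the common
     cardinality. *)
  have c_neq0 : (2 ^ (d - 1))%:R != 0 :> R by rewrite pnatr_eq0 -lt0n expn_gt0.
  apply: (mulfI c_neq0); rewrite -{1}(card_parity false) -(card_parity true).
  by rewrite !energy_max_parity.
Qed.
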